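(* Consider the two-dimensional Maxwell--Lorentz scheme of Joseph et al. with equal space steps $\delta x=\delta y>0$, in either of the polarisations $(B_x,B_y,E_z)$ or $(B_z,E_x,E_y)$, with $c_\infty,\epsilon_\infty,\omega_1,\delta t>0$, damping $\nu\ge0$ and $\epsilon_s\ge\epsilon_\infty$. In both polarisations: (i) (anharmonic case) if $\nu>0$ and $\epsilon_s\ge\epsilon_\infty$, the scheme is stable under the condition $\delta t\le\dfrac{\delta x}{2c_\infty}$; (ii) (harmonic case) if $\nu=0$ and $\epsilon_s>\epsilon_\infty$, the scheme is stable under the condition $\delta t\le\dfrac{\delta x}{2c_\infty}$.
   Context: Put $\lambda=c_\infty\delta t/\delta x$, $\delta=\nu\delta t/2$, $\omega=\omega_1^2\delta t^2/2$, $\epsilon_s'=\epsilon_s/\epsilon_\infty$ and, for $\xi=(\xi_x,\xi_y)\in\mathbb R^2$, $\sigma_x=\lambda(e^{i\xi_x}-1)$, $\sigma_y=\lambda(e^{i\xi_y}-1)$; a star denotes complex conjugation. Here $c_\infty$ is the light speed at infinite frequency. The scheme is the Yee (staggered leap-frog) discretization of Maxwell's equations closed, for each electric component, by a discretized Lorentz law linking $E$ and $D$; write $b=c_\infty B$, $e=E$, $d=D/(\epsilon_0\epsilon_\infty)$. For plane waves $e^{i(\xi_xj+\xi_yk)}$ (with $B$ at time $n-\frac12$ and $E,D$ at time $n$) the amplitudes evolve by one step as follows; old values carry no superscript, new values a superscript $+$, and $e^-$, $d^-$ are the values one step before $e$, $d$. Polarisation $(B_x,B_y,E_z)$, state $(b_x,b_y,e,e^-,d)\in\mathbb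 C^5$, new state $(b_x^+,b_y^+,e^+,e,d^+)$: $b_x^+=b_x-\sigma_ye$, $b_y^+=b_y+\sigma_xe$, $d^+=d+\sigma_y^*b_x^+-\sigma_x^*b_y^+$, $d^-=d-(\sigma_y^*b_x-\sigma_x^*b_y)$, and $$(1+\delta+\omega\epsilon_s')e^+-2e+(1-\delta+\omega\epsilon_s')e^-=(1+\delta+\omega)d^+-2d+(1-\delta+\omega)d^-.$$ Polarisation $(B_z,E_x,E_y)$, state $(b,e_x,e_x^-,d_x,e_y,e_y^-,d_y)\in\mathbb C^7$, new state $(b^+,e_x^+,e_x,d_x^+,e_y^+,e_y,d_y^+)$: $b^+=b+\sigma_ye_x-\sigma_xe_y$, $d_x^+=d_x-\sigma_y^*b^+$, $d_x^-=d_x+\sigma_y^*b$, $d_y^+=d_y+\sigma_x^*b^+$, $d_y^-=d_y-\sigma_x^*b$, and for each $a\in\{x,y\}$ $$(1+\delta+\omega\epsilon_s')e_a^+-2e_a+(1-\delta+\omega\epsilon_s')e_a^-=(1+\delta+\omega)d_a^+-2d_a+(1-\delta+\omega)d_a^-.$$ In each polarisation, $G(\xi)$ denotes the matrix of the linear map from old to new state (the amplification matrix). Stability (in the sense of von Neumann) means: for every $\xi\in\mathbb R^2$, the sequence of powers $(G(\xi)^n)_{n\ge0}$ is bounded. *)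

(* Defs.v *)
From mathcomp Require Import all_boot all_order all_algebra.
From mathcomp Require Import complex.
From mathcomp Require Import reals trigo.

Set Implicit Arguments.
Unset Strict Implicit.
Unset Printing Implicit Defensive.

Import Order.TTheory GRing.Theory Num.Theory.
Local Open Scope ring_scope.
Local Open Scope complex_scope.

Definition expi (R : realType) (t : R) : R[i] := cos t +i* sin t.

Definition sigma (R : realType) (lambda t : R) : R[i] :=
  lambda%:C * (expi t - 1).

(* Suffixes: p = one step after, m = one step before (superscripts +, -). *)
Definition lorentz_law (R : realType) (delta omega eps : R)
    (ep e em dp d dm : R[i]) : Prop :=
  (1 + delta + omega * eps)%:C * ep - 2 * e + (1 - delta + omega * eps)%:C * em
  = (1 + delta + omega)%:C * dp - 2 * d + (1 - delta + omega)%:C * dm.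

(* In the two relations below [s] is the old state and [s'] the new one.
   The component indices are numerals of 'I_5 and 'I_7, i.e. residues modulo
   5 and 7, all of them in range. *)

(* Polarisation (B_x, B_y, E_z): the state is (b_x, b_y, e, e^-, d). *)
Definition step_BxByEz (R : realType) (lambda delta omega eps : R) (xi : R * R)
    (s s' : 'cV[R[i]]_5) : Prop :=
  let sx := sigma lambda xi.1 in
  let sy := sigma lambda xi.2 in
  let bx := s 0 0 in let bx' := s' 0 0 in
  let by_ := s 1 0 in let by' := s' 1 0 in
  let e := s 2 0 in let e' := s' 2 0 in
  let em := s 3 0 in let em' := s' 3 0 in
  let d := s 4 0 in let d' := s' 4 0 in
  let dm := d - (sy^*%R * bx - sx^*%R * by_) in
  [/\ bx' = bx - sy * e,
      by' = by_ + sx * e,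
      d' = d + sy^*%R * bx' - sx^*%R * by',
      em' = e
    & lorentz_law delta omega eps e' e em d' d dm].

(* Polarisation (B_z, E_x, E_y): the state is
   (b, e_x, e_x^-, d_x, e_y, e_y^-, d_y). *)
Definition step_BzExEy (R : realType) (lambda delta omega eps : R) (xi : R * R)
    (s s' : 'cV[R[i]]_7) : Prop :=
  let sx := sigma lambda xi.1 in
  let sy := sigma lambda xi.2 in
  let b := s 0 0 in let b' := s' 0 0 in
  let ex := s 1 0 in let ex' := s' 1 0 in
  let exm := s 2 0 in let exm' := s' 2 0 in
  let dx := s 3 0 in let dx' := s' 3 0 in
  let ey := s 4 0 in let ey' := s' 4 0 in
  let eym := s 5 0 in let eym' := s' 5 0 in
  let dy := s 6 0 in let dy' := s' 6 0 in
  let dxm := dx + sy^*%R * b in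
  let dym := dy - sx^*%R * b in
  [/\ b' = b + sy * ex - sx * ey,
      dx' = dx - sy^*%R * b' /\ dy' = dy + sx^*%R * b',
      exm' = ex /\ eym' = ey,
      lorentz_law delta omega eps ex' ex exm dx' dx dxm
    & lorentz_law delta omega eps ey' ey eym dy' dy dym].

(* [G] is the matrix of the linear map from old to new state; the equivalence
   says that the scheme determines the new state and determines [G]. *)
Definition amplification_matrix (R : realType) (m : nat)
    (step : 'cV[R[i]]_m -> 'cV[R[i]]_m -> Prop) (G : 'M[R[i]]_m) : Prop :=
  forall s s' : 'cV[R[i]]_m, step s s' <-> s' = G *m s.

Definition power_bounded (R : realType) (m : nat) (G : 'M[R[i]]_m) : Prop :=
  exists M : R, forall (n : nat) (i j : 'I_m), `|(G ^+ n) i j| <= M%:C.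

Definition von_neumann_stable (R : realType) (m : nat)
    (step : R * R -> 'cV[R[i]]_m -> 'cV[R[i]]_m -> Prop) : Prop :=
  forall xi : R * R,
    exists2 G : 'M[R[i]]_m, amplification_matrix (step xi) G & power_bounded G.

(* Main.v *)
Require Import Defs.
From HB Require Import structures.
From mathcomp Require Import all_boot all_order all_algebra.
From mathcomp Require Import complex.
From mathcomp Require Import reals trigo.
From mathcomp Require Import ring lra.

(** For a fixed wave vector, boundedness of the powers of G is boundedness of
every trajectory. With q = |sigma_x|^2 + |sigma_y|^2 <= 2 the transverse part
of a trajectory satisfies d+ - 2 d + d- = - q e together with the Lorentz law,
a system with real coefficients; b and the individual components of d are
recovered from it by telescoping, and the longitudinal part has constant d.
For 0 < q < 2 and eps > 1 the real sequences carry a positive definite energy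
that the damping can only decrease. The energy degenerates exactly when q = 2
or eps = 1, and there the characteristic quartic splits into two coprime stable
quadratics. For q = 0 both b and d are constant. *)

Set Implicit Arguments.
Unset Strict Implicit.
Unset Printing Implicit Defensive.

Import Order.TTheory GRing.Theory Num.Theory.
Local Open Scope ring_scope.

(** * Bounded sequences and their linear combinations *)

Definition bounded_seq (K : numDomainType) (u : nat -> K) : Prop :=
  exists M : K, forall n, `|u n| <= M.

Lemma bounded_seq_cst (K : numDomainType) (a : K) : bounded_seq (fun=> a).
Proof. by exists `|a|. Qed.

Lemma bounded_seqS (K : numDomainType) (u : nat -> K) :
  bounded_seq u -> bounded_seq (fun n => u n.+1).
Proof. by move=> [M uM]; exists M. Qed.

Lemma bounded_seq_stationary (K : numDomainType) (u : nat -> K) :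
  (forall n, u n.+1 = u n) -> bounded_seq u.
Proof. by move=> uS; exists `|u 0%N|; elim=> // n; rewrite uS. Qed.

Lemma eq_bounded_seq (K : numDomainType) (u v : nat -> K) :
  u =1 v -> bounded_seq u -> bounded_seq v.
Proof. by move=> uv [M uM]; exists M => n; rewrite -uv. Qed.

(** The factor [r] stays on the side of [w], so that recovering a sequence from two bounded
    combinations needs only a division-free identity. *)
Lemma bounded_seq_lin (K : numFieldType) (r a b : K) (u v w : nat -> K) :
  r != 0 -> bounded_seq u -> bounded_seq v ->
  (forall n, r * w n = a * u n + b * v n) -> bounded_seq w.
Proof.
move=> r0 [M uM] [N vN] wE; exists (`|r|^-1 * (`|a| * M + `|b| * N)) => n.
have -> : w n = r^-1 * (a * u n + b * v n) by rewrite -wE mulKf.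
rewrite normrM normfV ler_wpM2l ?invr_ge0//.
by rewrite (le_trans (ler_normD _ _))// !normrM lerD// ler_wpM2l.
Qed.

Lemma bounded_seq_sqr (K : realFieldType) (C H : K) (u : nat -> K) :
  0 < C -> (forall n, C * u n ^+ 2 <= H) -> bounded_seq u.
Proof.
(* No square root is needed, since |u| <= 1 + u^2. *)
move=> C0 uH; exists (1 + H / C) => n.
have uHC : u n ^+ 2 <= H / C by rewrite ler_pdivlMr// mulrC.
rewrite ler_norml; apply/andP; split; nra.
Qed.

(** * Energy bounds for real linear recurrences *)

Lemma nonincreasing_le0 (K : numDomainType) (H : nat -> K) :
  (forall n, H n.+1 <= H n) -> forall n, H n <= H 0%N.
Proof. by move=> HS; elim=> // n /(le_trans (HS n)). Qed.

(* Multiplying the recurrence by [x n.+2 - x n] shows that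
   (alpha + gamma) / 2 * (x n.+1 ^+ 2 + x n ^+ 2) - 2 * beta * x n * x n.+1
   is nonincreasing. *)
Lemma quadratic_recurrence_bounded (K : realFieldType)
    (alpha beta gamma : K) (x : nat -> K) :
  gamma <= alpha -> `|2 * beta| < alpha + gamma ->
  (forall n, alpha * x n.+2 - 2 * beta * x n.+1 + gamma * x n = 0) ->
  bounded_seq x.
Proof.
move=> ga; rewrite ltr_norml => /andP[b1 b2] xE.
pose H n := (alpha + gamma) / 2 * (x n.+1 ^+ 2 + x n ^+ 2)
            - 2 * beta * (x n * x n.+1).
have HS n : H n.+1 <= H n.
  rewrite -subr_le0 /H.
  have -> : (alpha + gamma) / 2 * (x n.+2 ^+ 2 + x n.+1 ^+ 2)
      - 2 * beta * (x n.+1 * x n.+2)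
      - ((alpha + gamma) / 2 * (x n.+1 ^+ 2 + x n ^+ 2)
      - 2 * beta * (x n * x n.+1))
    = (alpha * x n.+2 - 2 * beta * x n.+1 + gamma * x n) * (x n.+2 - x n)
      - (alpha - gamma) / 2 * (x n.+2 - x n) ^+ 2 by field.
  by rewrite xE mul0r sub0r oppr_le0 mulr_ge0 ?sqr_ge0//; lra.
have H0 := nonincreasing_le0 HS.
(* [C] is the least eigenvalue of the quadratic form [H]; its positivity is the hypothesis on
   [beta]. *)
pose C := (alpha + gamma) / 2 - `|beta|.
have C0 : 0 < C by rewrite /C; case: (ger0P beta) => _; lra.
apply: (@bounded_seq_sqr _ C (H 0%N)) => // n; apply: le_trans (H0 n).
have xH : 0 <= C * x n.+1 ^+ 2 by rewrite mulr_ge0 ?sqr_ge0 ?ltW.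
apply: (@le_trans _ _ (C * (x n.+1 ^+ 2 + x n ^+ 2))); first by lra.
rewrite /H /C; case: (ger0P beta) => b0.
- have := mulr_ge0 b0 (sqr_ge0 (x n.+1 - x n)); lra.
- have : 0 <= - beta * (x n.+1 + x n) ^+ 2 by rewrite mulr_ge0 ?sqr_ge0//; lra.
  lra.
Qed.

(** Subtracting the fixed point a / r, where r is the characteristic polynomial at 1, removes the
    forcing; everything is scaled by r to avoid the quotient. *)
Lemma quadratic_recurrence_cst_bounded (K : realFieldType)
    (alpha beta gamma a : K) (x : nat -> K) :
  gamma <= alpha -> `|2 * beta| < alpha + gamma ->
  (forall n, alpha * x n.+2 - 2 * beta * x n.+1 + gamma * x n = a) ->
  bounded_seq x.
Proof.
move=> ga b xE; pose r := alpha - 2 * beta + gamma.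
have r0 : r != 0 by move: b; rewrite ltr_norml /r => /andP[? ?]; lra.
have yB : bounded_seq (fun n => r * x n - a).
  apply: quadratic_recurrence_bounded ga b _ => n.
  by rewrite -(xE n) /r; ring.
apply: (@bounded_seq_lin _ r 1 1 (fun n => r * x n - a) (fun=> a)) => //.
  exact: bounded_seq_cst.
by move=> n; ring.
Qed.

(* The characteristic polynomial is the product of Q1 = Z^2 - 2cZ + 1 and
   Q2 = alpha Z^2 - 2 beta Z + gamma. With g = 2 (beta - alpha c) and
   h = alpha - gamma, so that alpha Q1 - Q2 = g Z + h, the Bezout identity
   r = g^2 Q1 - (g Z - h - 2cg)(alpha Q1 - Q2) for
   r = (h + cg)^2 + (1 - c^2) g^2 writes x as a combination of Q1 x and Q2 x,
   each killed by the other factor. *)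
Lemma coprime_quadratics_bounded (K : realFieldType)
    (c alpha beta gamma : K) (x : nat -> K) :
  `|c| < 1 -> gamma <= alpha -> `|2 * beta| < alpha + gamma ->
  (gamma < alpha) || (beta != alpha * c) ->
  (forall n, alpha * x n.+4 - (2 * beta + 2 * c * alpha) * x n.+3
     + (alpha + gamma + 4 * beta * c) * x n.+2
     - (2 * beta + 2 * c * gamma) * x n.+1 + gamma * x n = 0) ->
  bounded_seq x.
Proof.
move=> c1 ga b copr xE.
pose y n := x n.+2 - 2 * c * x n.+1 + x n.
pose z n := alpha * x n.+2 - 2 * beta * x n.+1 + gamma * x n.
have yB : bounded_seq y.
  apply: quadratic_recurrence_bounded ga b _ => n.
  by rewrite -[RHS](xE n) /y; ring.
have zB : bounded_seq z.
  apply: (@quadratic_recurrence_bounded _ 1 c 1) => //.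
    by rewrite normrM ger0_norm//; lra.
  by move=> n; rewrite -[RHS](xE n) /z; ring.
pose g := 2 * (beta - alpha * c); pose h := alpha - gamma.
pose r := (h + c * g) ^+ 2 + (1 - c ^+ 2) * g ^+ 2.
have c2 : 0 < 1 - c ^+ 2.
  by move: c1; rewrite ltr_norml => /andP[? ?]; nra.
(* Both terms of [r] are nonnegative, so r = 0 would force g = h = 0, that is beta = alpha c and
   alpha = gamma, against [copr]. *)
have r0 : r != 0.
  have g2 : 0 <= (1 - c ^+ 2) * g ^+ 2 by rewrite mulr_ge0 ?sqr_ge0 ?ltW.
  rewrite /r (paddr_eq0 (sqr_ge0 _) g2) sqrf_eq0 (mulf_eq0 (1 - _)) sqrf_eq0.
  rewrite (gt_eqF c2) /=; apply/negP => /andP[/eqP hcg /eqP g0].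
  move: copr; rewrite g0 mulr0 addr0 /h in hcg.
  case/orP=> [|/eqP]; [by lra|apply].
  by move: g0; rewrite /g; lra.
pose k := h + 2 * c * g.
pose v n := (g ^+ 2 + alpha * k) * y n + (- k) * z n.
pose w n := (- (g * alpha)) * y n.+1 + g * z n.+1.
have vB : bounded_seq v.
  by apply: (bounded_seq_lin (oner_neq0 _) yB zB) => n; rewrite mul1r /v.
have wB : bounded_seq w.
  apply: (bounded_seq_lin (oner_neq0 _) (bounded_seqS yB) (bounded_seqS zB)).
  by move=> n; rewrite mul1r /w.
apply: (@bounded_seq_lin _ r 1 1 v w) => // n.
by rewrite /r /v /w /k /y /z /g /h; ring.
Qed.

(** * The real transverse system: second-order Maxwell recurrence and Lorentz law *)

Section LorentzSequences.
Variables (K : realFieldType) (q delta omega eps : K) (e d : nat -> K).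
Hypotheses (q_gt0 : 0 < q) (delta_ge0 : 0 <= delta) (omega_gt0 : 0 < omega).
Hypothesis maxwell :
  forall n, d n.+2 - 2 * d n.+1 + d n = - q * e n.+1.
Hypothesis lorentz : forall n,
  (1 + delta + omega * eps) * e n.+2 - 2 * e n.+1
    + (1 - delta + omega * eps) * e n
  = (1 + delta + omega) * d n.+2 - 2 * d n.+1 + (1 - delta + omega) * d n.

(* Writing D2 x = x+ - 2 x + x-, Dx = x+ - x-, M x = x+ + x- and kappa =
   omega (eps - 1): with P = d - e the law reads
   D2 P + delta DP + omega MP = kappa M e; test it with P+ - P-
   and use d+ - 2 d + d- = - q e to telescope the right-hand side. *)
Lemma lorentz_energy_bounded : q < 2 -> 1 < eps ->
  bounded_seq e /\ bounded_seq d.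
Proof using q_gt0 delta_ge0 omega_gt0 maxwell lorentz.
move=> q2 eps1; pose P n := d n - e n.
pose kappa := omega * (eps - 1).
have k0 : 0 < kappa by rewrite mulr_gt0// subr_gt0.
(* [W] is chosen so that, by the Maxwell recurrence, W n.+1 - W n = - (e n.+2 + e n) (P n.+2 - P
   n). *)
pose W n := e n.+1 ^+ 2 + e n ^+ 2 + 2 / q * (d n.+1 - d n) ^+ 2
  - 2 * (d n.+1 - d n) * (e n.+1 - e n) - q * e n * e n.+1.
pose H n := (P n.+1 - P n) ^+ 2 + omega * (P n.+1 ^+ 2 + P n ^+ 2)
  + kappa * W n.
have HS n : H n.+1 <= H n.
  suff -> : H n.+1 = H n - delta * (P n.+2 - P n) ^+ 2.
    by rewrite gerBl mulr_ge0 ?sqr_ge0.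
  have dE : d n.+2 = 2 * d n.+1 - d n - q * e n.+1.
    by rewrite -[RHS]addrA -mulNr -maxwell; ring.
  apply/eqP; rewrite -subr_eq0; apply/eqP.
  have -> : H n.+1 - (H n - delta * (P n.+2 - P n) ^+ 2) =
     ((1 + delta + omega) * d n.+2 - 2 * d n.+1 + (1 - delta + omega) * d n
      - ((1 + delta + omega * eps) * e n.+2 - 2 * e n.+1
    + (1 - delta + omega * eps) * e n)) * (P n.+2 - P n).
    rewrite /H /W /P /kappa dE; field; exact: lt0r_neq0.
  by rewrite lorentz subrr mul0r.
have H0 := nonincreasing_le0 HS.
(* Completing the square in the increment of [d] leaves (1 - q / 2) (e n.+1 ^ 2 + e n ^ 2), which
   controls [e] because q < 2. *)
have W_ge n : (1 - q / 2) * e n ^+ 2 <= W n.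
  pose a := e n.+1 - e n; pose c := d n.+1 - d n.
  have -> : W n = (2 / q) * (c - q / 2 * a) ^+ 2
    + (1 - q / 2) * (e n.+1 ^+ 2 + e n ^+ 2).
    rewrite /W /a /c; field; exact: lt0r_neq0.
  have : 0 <= 2 / q * (c - q / 2 * a) ^+ 2.
    by rewrite mulr_ge0 ?sqr_ge0// divr_ge0// ltW.
  have : 0 <= (1 - q / 2) * e n.+1 ^+ 2.
    by rewrite mulr_ge0 ?sqr_ge0//; lra.
  by lra.
have W0 n : 0 <= W n.
  by apply: le_trans (W_ge n); rewrite mulr_ge0 ?sqr_ge0//; lra.
have eB : bounded_seq e.
  apply: (@bounded_seq_sqr _ (kappa * (1 - q / 2)) (H 0%N)).
    by rewrite mulr_gt0//; lra.
  move=> n; apply: le_trans (H0 n); rewrite -mulrA /H.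
  rewrite (le_trans (ler_wpM2l (ltW k0) (W_ge n)))// lerDr addr_ge0 ?sqr_ge0//.
  by rewrite mulr_ge0 ?addr_ge0 ?sqr_ge0 ?ltW.
have PB : bounded_seq P.
  apply: (@bounded_seq_sqr _ omega (H 0%N)) => // n.
  apply: le_trans (H0 n); rewrite /H.
  have := mulr_ge0 (ltW k0) (W0 n).
  have := sqr_ge0 (P n.+1 - P n).
  have := mulr_ge0 (ltW omega_gt0) (sqr_ge0 (P n.+1)).
  by lra.
split=> //; apply: (bounded_seq_lin (oner_neq0 _) eB PB (a := 1) (b := 1)).
by move=> n; rewrite /P; ring.
Qed.

(** This recurrence results from eliminating [e] or [d]. With A = (1 + delta + omega) Z^2 - 2 Z + (1
    - delta + omega) and kappa = omega (eps - 1), its polynomial is (Z^2 - (2 - q) Z + 1) A when eps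
    = 1, and (Z^2 + 1) (A + kappa (Z - 1)^2) when q = 2. The factors are coprime thanks to delta > 0
    in the first case, and to a nonzero middle coefficient of the second factor in the other. *)
Lemma lorentz_quartic_bounded (x : nat -> K) :
  q <= 2 -> 1 <= eps -> (0 < delta) || (1 < eps) -> (q < 2) ==> (eps == 1) ->
  (forall n,
     (1 + delta + omega * eps) * (x n.+4 - 2 * x n.+3 + x n.+2)
     - 2 * (x n.+3 - 2 * x n.+2 + x n.+1)
     + (1 - delta + omega * eps) * (x n.+2 - 2 * x n.+1 + x n)
     + q * ((1 + delta + omega) * x n.+3 - 2 * x n.+2
         + (1 - delta + omega) * x n.+1) = 0) ->
  bounded_seq x.
Proof using q_gt0 delta_ge0 omega_gt0.
move: q_gt0 delta_ge0 omega_gt0 => q0 delta0 omega0 q2 eps1 hde qe xE.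
have [epsE|epsN1] := eqVneq eps 1.
  have dp : 0 < delta by move: hde; rewrite epsE ltxx orbF.
  apply: (@coprime_quadratics_bounded _ (1 - q / 2)
    (1 + delta + omega) 1 (1 - delta + omega)).
  - by rewrite ltr_norml; apply/andP; split; lra.
  - by lra.
  - by rewrite gtr0_norm; lra.
  - by apply/orP; left; lra.
  - by move=> n; rewrite -[RHS](xE n) epsE; field.
have eps_gt1 : 1 < eps by rewrite lt_neqAle eq_sym epsN1.
have qE : q = 2.
  by apply/eqP; rewrite eq_le q2 leNgt; move: qe; rewrite (negPf epsN1) implybF.
have oe : 0 < omega * (eps - 1) by rewrite mulr_gt0// subr_gt0.
apply: (@coprime_quadratics_bounded _ 0 (1 + delta + omega * eps)
  (1 + omega * (eps - 1)) (1 - delta + omega * eps)).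
- by rewrite normr0.
- by lra.
- by rewrite gtr0_norm; lra.
- by rewrite mulr0 lt0r_neq0 ?orbT//; lra.
- by move=> n; rewrite -[RHS](xE n) qE; ring.
Qed.

Lemma lorentz_sequences_bounded : q <= 2 -> 1 <= eps ->
  (0 < delta) || (1 < eps) -> bounded_seq e /\ bounded_seq d.
Proof using q_gt0 delta_ge0 omega_gt0 maxwell lorentz.
move=> q2 eps1 hde.
have [/andP[q_lt2 epsN1]|] := boolP ((q < 2) && (eps != 1)).
  by apply: lorentz_energy_bounded => //; rewrite lt_neqAle eq_sym epsN1.
rewrite negb_and negbK -implybE => qe.
split; apply: lorentz_quartic_bounded => // n; last first.
  (* For [d]: second differences of [d] turn into multiples of [e], and the law closes the
     identity. *)
  by rewrite !maxwell -lorentz; ring.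
pose L k := (1 + delta + omega * eps) * e k.+2 - 2 * e k.+1
    + (1 - delta + omega * eps) * e k
  - ((1 + delta + omega) * d k.+2 - 2 * d k.+1 + (1 - delta + omega) * d k).
pose N k := d k.+2 - 2 * d k.+1 + d k + q * e k.+1.
have L0 k : L k = 0 by rewrite /L lorentz subrr.
have N0 k : N k = 0 by rewrite /N maxwell; ring.
(* For [e]: the second difference of the law plus the [d]-side Lorentz operator applied to the
   Maxwell relation; all terms in [d] cancel. *)
transitivity (L n.+2 - 2 * L n.+1 + L n + (1 + delta + omega) * N n.+2
  - 2 * N n.+1 + (1 - delta + omega) * N n); last by rewrite !L0 !N0; ring.
by rewrite /L /N; ring.
Qed.

End LorentzSequences.

Local Open Scope complex_scope.

(** * Transfer to complex amplitudes through real and imaginary parts *)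

Section ComplexSequences.
Variable R : realType.
Implicit Types u : nat -> R[i].

Lemma bounded_seq_ReIm u :
  bounded_seq (fun n => complex.Re (u n)) ->
  bounded_seq (fun n => complex.Im (u n)) ->
  bounded_seq u.
Proof.
have toC (v : nat -> R) : bounded_seq v -> bounded_seq (fun n => (v n)%:C).
  move=> [M vM]; exists M%:C => n.
  by rewrite normc_def /= expr0n /= addr0 sqrtr_sqr lecR.
move=> reB imB; have {}reB := toC _ reB; have {}imB := toC _ imB.
apply: (bounded_seq_lin (oner_neq0 _) reB imB (a := 1) (b := 'i%C)) => n.
by case: (u n) => a b; rewrite !mul1r /=; simpc.
Qed.

Lemma bounded_seq_complexP u :
  bounded_seq u -> exists M : R, forall n, `|u n| <= M%:C.
Proof.
(* A complex number that dominates a norm is nonnegative, hence real. *)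
move=> [M uM]; exists (complex.Re M) => n.
rewrite (le_trans (uM n))// RRe_real// ger0_real//.
exact: le_trans (uM 0%N).
Qed.

Lemma lorentz_law_Re (delta omega eps : R) (ep e em dp d dm : R[i]) :
  lorentz_law delta omega eps ep e em dp d dm ->
  (1 + delta + omega * eps) * complex.Re ep - 2 * complex.Re e
    + (1 - delta + omega * eps) * complex.Re em
  = (1 + delta + omega) * complex.Re dp - 2 * complex.Re d
    + (1 - delta + omega) * complex.Re dm.
Proof.
case: ep e em dp d dm => ? ? [? ?] [? ?] [? ?] [? ?] [? ?].
(* The products 2 * x become x + x, so that [simpc] can split the equation into components. *)
rewrite /lorentz_law !(mulrDl 1 1) !mul1r; simpc => -[/= E _].
by move: E; lra.
Qed.

Lemma lorentz_law_Im (delta omega eps : R) (ep e em dp d dm : R[i]) :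
  lorentz_law delta omega eps ep e em dp d dm ->
  (1 + delta + omega * eps) * complex.Im ep - 2 * complex.Im e
    + (1 - delta + omega * eps) * complex.Im em
  = (1 + delta + omega) * complex.Im dp - 2 * complex.Im d
    + (1 - delta + omega) * complex.Im dm.
Proof.
case: ep e em dp d dm => ? ? [? ?] [? ?] [? ?] [? ?] [? ?].
rewrite /lorentz_law !(mulrDl 1 1) !mul1r; simpc => -[/= _ E].
by move: E; lra.
Qed.

Lemma lorentz_law_lin (delta omega eps : R) (a b : R[i])
    (ep e em dp d dm ep' e' em' dp' d' dm' : R[i]) :
  lorentz_law delta omega eps ep e em dp d dm ->
  lorentz_law delta omega eps ep' e' em' dp' d' dm' ->
  lorentz_law delta omega eps (a * ep + b * ep') (a * e + b * e')
    (a * em + b * em') (a * dp + b * dp') (a * d + b * d') (a * dm + b * dm').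
Proof.
rewrite /lorentz_law => /(congr1 ( *%R a)) E /(congr1 ( *%R b)) E'.
transitivity (a * ((1 + delta + omega * eps)%:C * ep - 2 * e
    + (1 - delta + omega * eps)%:C * em)
  + b * ((1 + delta + omega * eps)%:C * ep' - 2 * e'
    + (1 - delta + omega * eps)%:C * em')); first by ring.
by rewrite E E'; ring.
Qed.

Variables (q delta omega eps : R) (e d : nat -> R[i]).
Hypotheses (delta_ge0 : 0 <= delta) (omega_gt0 : 0 < omega).
Hypothesis eps_ge1 : 1 <= eps.
Hypothesis lorentz : forall n, lorentz_law delta omega eps
  (e n.+2) (e n.+1) (e n) (d n.+2) (d n.+1) (d n).

Lemma lorentz_maxwell_bounded : 0 < q -> q <= 2 ->
  (0 < delta) || (1 < eps) ->
  (forall n, d n.+2 - 2 * d n.+1 + d n = - q%:C * e n.+1) ->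
  bounded_seq e /\ bounded_seq d.
Proof using delta_ge0 omega_gt0 eps_ge1 lorentz.
move=> q0 q2 hde maxwell.
have [eRe dRe] : bounded_seq (fun n => complex.Re (e n)) /\
                 bounded_seq (fun n => complex.Re (d n)).
  apply: (@lorentz_sequences_bounded _ q delta omega eps) => // n.
    move: (maxwell n); case: (d n.+2) (d n.+1) (d n) (e n.+1).
    move=> ? ? [? ?] [? ?] [? ?].
    by rewrite !(mulrDl 1 1) !mul1r; simpc => -[/= E _]; move: E; lra.
  exact: lorentz_law_Re.
have [eIm dIm] : bounded_seq (fun n => complex.Im (e n)) /\
                 bounded_seq (fun n => complex.Im (d n)).
  apply: (@lorentz_sequences_bounded _ q delta omega eps) => // n.
    move: (maxwell n); case: (d n.+2) (d n.+1) (d n) (e n.+1).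
    move=> ? ? [? ?] [? ?] [? ?].
    by rewrite !(mulrDl 1 1) !mul1r; simpc => -[/= _ E]; move: E; lra.
  exact: lorentz_law_Im.
by split; apply: bounded_seq_ReIm.
Qed.

(** With [d] constant the law is a stable second-order recurrence for [e], forced by the constant 2
    omega d. This serves both q = 0 and the longitudinal field. *)
Lemma lorentz_static_bounded : (forall n, d n.+1 = d n) -> bounded_seq e.
Proof using delta_ge0 omega_gt0 eps_ge1 lorentz.
move: delta_ge0 omega_gt0 eps_ge1 => delta0 omega0 eps1.
move=> dS; have d0 n : d n = d 0%N by elim: n => // n <-.
have oe : 0 < omega * eps by rewrite mulr_gt0//; lra.
apply: bounded_seq_ReIm.
  apply: (@quadratic_recurrence_cst_bounded _ (1 + delta + omega * eps) 1
    (1 - delta + omega * eps) (2 * omega * complex.Re (d 0%N))).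
  - by lra.
  - by rewrite gtr0_norm; lra.
  - by move=> n; have /lorentz_law_Re := lorentz n; rewrite !dS !d0 => E; lra.
apply: (@quadratic_recurrence_cst_bounded _ (1 + delta + omega * eps) 1
  (1 - delta + omega * eps) (2 * omega * complex.Im (d 0%N))).
- by lra.
- by rewrite gtr0_norm; lra.
- by move=> n; have /lorentz_law_Im := lorentz n; rewrite !dS !d0 => E; lra.
Qed.

End ComplexSequences.

(** * From bounded trajectories to bounded matrix powers *)

(** Column j of G^n is the trajectory issued from the j-th basis vector; an explicit linear [F]
    supplies existence and uniqueness of the new state. *)
Lemma linear_step_stable (R : realType) (m : nat)
    (step : 'cV[R[i]]_m -> 'cV[R[i]]_m -> Prop)
    (F : 'cV[R[i]]_m -> 'cV[R[i]]_m) :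
  linear F -> (forall s s', step s s' <-> s' = F s) ->
  (forall u : nat -> 'cV[R[i]]_m, (forall n, step (u n) (u n.+1)) ->
     forall i, bounded_seq (fun n => u n i 0)) ->
  exists2 G, amplification_matrix step G & power_bounded G.
Proof.
move=> Flin stepE uB.
pose Fm := GRing.isLinear.Build _ _ _ _ F Flin.
pose L : {linear 'cV[R[i]]_m -> 'cV[R[i]]_m} := HB.pack F Fm.
pose G : 'M[R[i]]_m := \matrix_(i, j) F (delta_mx j 0) i 0.
have GE s : G *m s = F s.
  apply/colP => i; rewrite mxE [in RHS](matrix_sum_delta s).
  rewrite -[F]/(L : _ -> _) linear_sum summxE; apply: eq_bigr => j _.
  by rewrite big_ord1 linearZ !mxE mulrC.
exists G; first by move=> s s'; rewrite GE; exact: stepE.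
have colB j i : exists M : R, forall n, `|(G ^+ n) i j| <= M%:C.
  apply: bounded_seq_complexP.
  have := uB (fun n => G ^+ n *m delta_mx j 0).
  have colE n : (G ^+ n *m delta_mx j 0 : 'cV_m) = col j (G ^+ n).
    by rewrite colE.
  move=> /(_ _ i) [|M HM]; last first.
    by exists M => n; have := HM n; rewrite colE mxE.
  by move=> n; apply/stepE; rewrite -GE exprS -mulmxE mulmxA.
have [M HM] := fin_all_exists (fun ij : 'I_m * 'I_m => colB ij.2 ij.1).
(* The sum of the finitely many entrywise bounds is a common bound. *)
exists (\sum_ij `|M ij|) => n i j; apply: le_trans (HM (i, j) n) _.
rewrite lecR (bigD1 (i, j))//= (le_trans (ler_norm _))// lerDl.
exact: sumr_ge0.
Qed.

(** * Fourier symbols and enumeration of the state components *)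

Lemma sigma_norm (R : realType) (lambda t : R) :
  sigma lambda t * (sigma lambda t)^*%R
  = (lambda ^+ 2 * (2 - 2 * cos t))%:C.
Proof.
rewrite /sigma /expi; change (@Num.conj R[i]) with (@conjc R).
rewrite -[1]/(1%:C); simpc; apply/eqP; rewrite eq_complex /=.
have c2s2 := cos2Dsin2 t.
apply/andP; split; apply/eqP; last by ring.
transitivity (lambda ^+ 2 * ((cos t ^+ 2 + sin t ^+ 2) - 2 * cos t + 1)).
  by ring.
by rewrite c2s2; ring.
Qed.

(** The numerals are residues modulo 5, so each concrete ordinal has to be identified with one of
    them by its value. *)
Lemma forall_ord5 (P : 'I_5 -> Prop) :
  P 0 -> P 1 -> P 2 -> P 3 -> P 4 -> forall i, P i.
Proof.
move=> P0 P1 P2 P3 P4 [[|[|[|[|[|//]]]]] lt].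
- by rewrite (_ : Ordinal lt = 0)//; apply: val_inj.
- by rewrite (_ : Ordinal lt = 1)//; apply: val_inj.
- by rewrite (_ : Ordinal lt = 2)//; apply: val_inj.
- by rewrite (_ : Ordinal lt = 3)//; apply: val_inj.
- by rewrite (_ : Ordinal lt = 4)//; apply: val_inj.
Qed.

Lemma forall_ord7 (P : 'I_7 -> Prop) :
  P 0 -> P 1 -> P 2 -> P 3 -> P 4 -> P 5 -> P 6 -> forall i, P i.
Proof.
move=> P0 P1 P2 P3 P4 P5 P6 [[|[|[|[|[|[|[|//]]]]]]] lt].
- by rewrite (_ : Ordinal lt = 0)//; apply: val_inj.
- by rewrite (_ : Ordinal lt = 1)//; apply: val_inj.
- by rewrite (_ : Ordinal lt = 2)//; apply: val_inj.
- by rewrite (_ : Ordinal lt = 3)//; apply: val_inj.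
- by rewrite (_ : Ordinal lt = 4)//; apply: val_inj.
- by rewrite (_ : Ordinal lt = 5)//; apply: val_inj.
- by rewrite (_ : Ordinal lt = 6)//; apply: val_inj.
Qed.

(** * Stability of the two polarisations at a fixed wave vector *)

Section Schemes.
Variables (R : realType) (lambda delta omega eps : R) (xi : R * R).
Hypotheses (delta_ge0 : 0 <= delta) (omega_gt0 : 0 < omega).
Hypotheses (eps_ge1 : 1 <= eps) (lossy_or_gt1 : (0 < delta) || (1 < eps)).
Hypotheses (lambda_ge0 : 0 <= lambda) (lambda_le : lambda <= 1 / 2).

Definition explicit_e (e em dp d dm : R[i]) : R[i] :=
  ((1 + delta + omega)%:C * dp - 2 * d + (1 - delta + omega)%:C * dm
   + 2 * e - (1 - delta + omega * eps)%:C * em)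
  / (1 + delta + omega * eps)%:C.

Lemma lorentz_lead_neq0 : (1 + delta + omega * eps)%:C != 0.
Proof using delta_ge0 omega_gt0 eps_ge1.
have oe : 0 < omega * eps by rewrite mulr_gt0// (lt_le_trans ltr01).
by rewrite fmorph_eq0 lt0r_neq0// ltr_wpDl// addr_ge0.
Qed.

Lemma lorentz_lawE (ep e em dp d dm : R[i]) :
  lorentz_law delta omega eps ep e em dp d dm <-> ep = explicit_e e em dp d dm.
Proof using delta_ge0 omega_gt0 eps_ge1.
have a0 := lorentz_lead_neq0; rewrite /lorentz_law /explicit_e; split.
  by move=> <-; apply: (mulfI a0); rewrite [RHS]mulrC divfK//; ring.
by move=> ->; rewrite mulrCA divff// mulr1; ring.
Qed.

Let sx := sigma lambda xi.1.
Let sy := sigma lambda xi.2.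
Let q := lambda ^+ 2 * (2 - 2 * cos xi.1) + lambda ^+ 2 * (2 - 2 * cos xi.2).

(* q is the symbol of the discrete Laplacian; the CFL condition gives q <= 2. *)
Lemma sigma_sqnorm : sx * sx^*%R + sy * sy^*%R = q%:C.
Proof using. by rewrite !sigma_norm -rmorphD. Qed.

(** Each direction contributes at most 4 lambda^2 <= 1. *)
Lemma q_le2 : q <= 2.
Proof using lambda_ge0 lambda_le.
have l2 : lambda ^+ 2 <= 1 / 4 by move: lambda_ge0 lambda_le => *; nra.
have l0 := sqr_ge0 lambda.
have c1 := cos_geN1 xi.1; have c2 := cos_geN1 xi.2; rewrite /q; nra.
Qed.

Lemma q_ge0 : 0 <= q.
Proof using.
rewrite addr_ge0// mulr_ge0 ?sqr_ge0//.
  by have := cos_le1 xi.1; lra.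
by have := cos_le1 xi.2; lra.
Qed.

Lemma sigma_eq0 : q = 0 -> sx = 0 /\ sy = 0.
Proof using.
move=> q0; have := sigma_sqnorm; rewrite q0 rmorph0 -!normCK => /eqP.
by rewrite paddr_eq0 ?exprn_ge0// !sqrf_eq0 !normr_eq0 => /andP[/eqP-> /eqP->].
Qed.

(** Here the electric field is scalar and purely transverse; the magnetic field is then recovered
    from its discrete curl and divergence. *)
Lemma BxByEz_stable :
  exists2 G, amplification_matrix (step_BxByEz lambda delta omega eps xi) G
           & power_bounded G.
Proof using delta_ge0 omega_gt0 eps_ge1 lossy_or_gt1 lambda_ge0 lambda_le.
pose dp (s : 'cV[R[i]]_5) := s 4 0 + sy^*%R * (s 0 0 - sy * s 2 0)
  - sx^*%R * (s 1 0 + sx * s 2 0).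
pose dm (s : 'cV[R[i]]_5) := s 4 0 - (sy^*%R * s 0 0 - sx^*%R * s 1 0).
pose F (s : 'cV[R[i]]_5) : 'cV[R[i]]_5 := \col_i nth 0 [::
  s 0 0 - sy * s 2 0; s 1 0 + sx * s 2 0;
  explicit_e (s 2 0) (s 3 0) (dp s) (s 4 0) (dm s); s 2 0; dp s] i.
apply: (@linear_step_stable _ _ _ F).
- move=> k u v; apply/colP; apply: forall_ord5;
    by rewrite !mxE /= /explicit_e /dp /dm ?mxE; ring.
- move=> s s'; rewrite /step_BxByEz /= -/sx -/sy; split.
    move=> [s0 s1 s4 s3 /lorentz_lawE s2].
    apply/colP; apply: forall_ord5; rewrite mxE //=.
      by rewrite s2 s4 s0 s1.
    by rewrite s4 s0 s1.
  move=> ->; split; rewrite ?mxE //=.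
  by apply/lorentz_lawE.
move=> u uS.
(* Indexing by the delayed values e^- and d^- makes the law hold from n = 0 on; the current values
   are E n.+1 and D n.+1. *)
pose E n := u n 3 0; pose D n := dm (u n).
have ES n : u n 2 0 = E n.+1 by case: (uS n).
have DS n : u n 4 0 = D n.+1.
  by case: (uS n) => s0 s1 s4 _ _; rewrite /D /dm s4 -/sx -/sy; ring.
have law n : lorentz_law delta omega eps
    (E n.+2) (E n.+1) (E n) (D n.+2) (D n.+1) (D n).
  by case: (uS n) => _ _ _ _; rewrite -!ES -!DS.
have bxS n : u n.+1 0 0 = u n 0 0 - sy * E n.+1.
  by rewrite -ES; case: (uS n).
have byS n : u n.+1 1 0 = u n 1 0 + sx * E n.+1.
  by rewrite -ES; case: (uS n).
have curl n : D n.+1 - D n = sy^*%R * u n 0 0 - sx^*%R * u n 1 0.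
  by rewrite -DS /D /dm; ring.
suff [BE BD Bx By] : [/\ bounded_seq E, bounded_seq D,
    bounded_seq (fun n => u n 0 0) & bounded_seq (fun n => u n 1 0)].
  apply: forall_ord5 => //.
    by apply: eq_bounded_seq (bounded_seqS BE) => n; rewrite ES.
  by apply: eq_bounded_seq (bounded_seqS BD) => n; rewrite DS.
have [q0|qN0] := eqVneq q 0.
  have [sx0 sy0] := sigma_eq0 q0.
  have DC n : D n.+1 = D n.
    by apply/eqP; rewrite -subr_eq0 curl sx0 sy0 rmorph0; apply/eqP; ring.
  split; [|exact: bounded_seq_stationary|..].
  - exact: lorentz_static_bounded law DC.
  - by apply: bounded_seq_stationary => n; rewrite bxS sy0; ring.
  - by apply: bounded_seq_stationary => n; rewrite byS sx0; ring.
have qp : 0 < q by rewrite lt_def qN0 q_ge0.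
have qC0 : q%:C != 0 by rewrite fmorph_eq0.
have maxwell n : D n.+2 - 2 * D n.+1 + D n = - q%:C * E n.+1.
  transitivity ((D n.+2 - D n.+1) - (D n.+1 - D n)); first by ring.
  by rewrite !curl bxS byS -sigma_sqnorm; ring.
have [BE BD] := lorentz_maxwell_bounded delta_ge0 omega_gt0 eps_ge1 law qp q_le2
  lossy_or_gt1 maxwell.
have BdD : bounded_seq (fun n => D n.+1 - D n).
  apply: (bounded_seq_lin (oner_neq0 _) (bounded_seqS BD) BD
    (a := 1) (b := -1)).
  by move=> n; ring.
(* The discrete divergence of the magnetic field is conserved. *)
have Bdiv : bounded_seq (fun n => sx * u n 0 0 + sy * u n 1 0).
  by apply: bounded_seq_stationary => n; rewrite bxS byS; ring.
split=> //.
(* Curl and divergence form a 2 by 2 system for b_x, b_y with determinant [q] up to sign. *)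
- apply: (bounded_seq_lin qC0 BdD Bdiv (a := sy) (b := sx^*%R)) => n.
  by rewrite curl -sigma_sqnorm; ring.
- apply: (bounded_seq_lin qC0 BdD Bdiv (a := - sx) (b := sy^*%R)) => n.
  by rewrite curl -sigma_sqnorm; ring.
Qed.

(** The law has the same coefficients in both directions, so it passes to the transverse and
    longitudinal combinations, which decouple. *)
Lemma BzExEy_stable :
  exists2 G, amplification_matrix (step_BzExEy lambda delta omega eps xi) G
           & power_bounded G.
Proof using delta_ge0 omega_gt0 eps_ge1 lossy_or_gt1 lambda_ge0 lambda_le.
pose bp (s : 'cV[R[i]]_7) := s 0 0 + sy * s 1 0 - sx * s 4 0.
pose dxp (s : 'cV[R[i]]_7) := s 3 0 - sy^*%R * bp s.
pose dyp (s : 'cV[R[i]]_7) := s 6 0 + sx^*%R * bp s.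
pose dxm (s : 'cV[R[i]]_7) := s 3 0 + sy^*%R * s 0 0.
pose dym (s : 'cV[R[i]]_7) := s 6 0 - sx^*%R * s 0 0.
pose F (s : 'cV[R[i]]_7) : 'cV[R[i]]_7 := \col_i nth 0 [:: bp s;
  explicit_e (s 1 0) (s 2 0) (dxp s) (s 3 0) (dxm s); s 1 0; dxp s;
  explicit_e (s 4 0) (s 5 0) (dyp s) (s 6 0) (dym s); s 4 0; dyp s] i.
apply: (@linear_step_stable _ _ _ F).
- move=> k u v; apply/colP; apply: forall_ord7;
    by rewrite !mxE /= /explicit_e /dxp /dyp /dxm /dym /bp ?mxE; ring.
- move=> s s'; rewrite /step_BzExEy /= -/sx -/sy; split.
    move=> [s0 [s3 s6] [s2 s5] /lorentz_lawE s1 /lorentz_lawE s4].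
    apply/colP; apply: forall_ord7; rewrite mxE //=.
    + by rewrite s1 s3 s0.
    + by rewrite s3 s0.
    + by rewrite s4 s6 s0.
    + by rewrite s6 s0.
  move=> ->; split; rewrite ?mxE //=.
  + exact: (lorentz_lawE _ _ _ _ _ _).2.
  + exact: (lorentz_lawE _ _ _ _ _ _).2.
move=> u uS.
pose Ex n := u n 2 0; pose Dx n := dxm (u n).
pose Ey n := u n 5 0; pose Dy n := dym (u n); pose B n := u n 0 0.
have ExS n : u n 1 0 = Ex n.+1 by case: (uS n) => _ _ [].
have EyS n : u n 4 0 = Ey n.+1 by case: (uS n) => _ _ [].
have DxS n : u n 3 0 = Dx n.+1.
  by case: (uS n) => _ [s3 _] _ _ _; rewrite /Dx /dxm s3 -/sy; ring.
have DyS n : u n 6 0 = Dy n.+1.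
  by case: (uS n) => _ [_ s6] _ _ _; rewrite /Dy /dym s6 -/sx; ring.
have lawx n : lorentz_law delta omega eps
    (Ex n.+2) (Ex n.+1) (Ex n) (Dx n.+2) (Dx n.+1) (Dx n).
  by case: (uS n) => _ _ _ + _; rewrite -!ExS -!DxS.
have lawy n : lorentz_law delta omega eps
    (Ey n.+2) (Ey n.+1) (Ey n) (Dy n.+2) (Dy n.+1) (Dy n).
  by case: (uS n) => _ _ _ _; rewrite -!EyS -!DyS.
have BS n : B n.+1 = B n + sy * Ex n.+1 - sx * Ey n.+1.
  by rewrite -ExS -EyS; case: (uS n).
have dDx n : Dx n.+1 = Dx n - sy^*%R * B n by rewrite -DxS /Dx /dxm /B; ring.
have dDy n : Dy n.+1 = Dy n + sx^*%R * B n by rewrite -DyS /Dy /dym /B; ring.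
suff [[BEx BDx] [BEy BDy] BB] : [/\ bounded_seq Ex /\ bounded_seq Dx,
    bounded_seq Ey /\ bounded_seq Dy & bounded_seq B].
  apply: forall_ord7 => //.
  - by apply: eq_bounded_seq (bounded_seqS BEx) => n; rewrite ExS.
  - by apply: eq_bounded_seq (bounded_seqS BDx) => n; rewrite DxS.
  - by apply: eq_bounded_seq (bounded_seqS BEy) => n; rewrite EyS.
  - by apply: eq_bounded_seq (bounded_seqS BDy) => n; rewrite DyS.
have [q0|qN0] := eqVneq q 0.
  have [sx0 sy0] := sigma_eq0 q0.
  have DxC n : Dx n.+1 = Dx n by rewrite dDx sy0 rmorph0; ring.
  have DyC n : Dy n.+1 = Dy n by rewrite dDy sx0 rmorph0; ring.
  split; [split|split|].
  - exact: lorentz_static_bounded lawx DxC.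
  - exact: bounded_seq_stationary.
  - exact: lorentz_static_bounded lawy DyC.
  - exact: bounded_seq_stationary.
  - by apply: bounded_seq_stationary => n; rewrite BS sx0 sy0; ring.
have qp : 0 < q by rewrite lt_def qN0 q_ge0.
have qC0 : q%:C != 0 by rewrite fmorph_eq0.
(* [ET], [DT] are the transverse components, driven by [B]; [EL], [DL] are the longitudinal ones,
   for which [B] cancels. *)
pose ET n := sy * Ex n + (- sx) * Ey n.
pose DT n := sy * Dx n + (- sx) * Dy n.
pose EL n := sx^*%R * Ex n + sy^*%R * Ey n.
pose DL n := sx^*%R * Dx n + sy^*%R * Dy n.
have dDT n : DT n.+1 = DT n - q%:C * B n.
  by rewrite /DT dDx dDy -sigma_sqnorm; ring.
have [BET BDT] : bounded_seq ET /\ bounded_seq DT.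
  apply: (lorentz_maxwell_bounded delta_ge0 omega_gt0 eps_ge1 _ qp q_le2)
    => // n.
    exact: lorentz_law_lin (lawx n) (lawy n).
  by rewrite !dDT BS /ET; ring.
have DLC n : DL n.+1 = DL n by rewrite /DL dDx dDy; ring.
have BDL := bounded_seq_stationary DLC.
have BEL : bounded_seq EL.
  apply: (lorentz_static_bounded delta_ge0 omega_gt0 eps_ge1 _ DLC) => n.
  exact: lorentz_law_lin (lawx n) (lawy n).
split; [split|split|].
(* The change of components is inverted up to the factor [q]. *)
- apply: (bounded_seq_lin qC0 BET BEL (a := sy^*%R) (b := sx)) => n.
  by rewrite /ET /EL -sigma_sqnorm; ring.
- apply: (bounded_seq_lin qC0 BDT BDL (a := sy^*%R) (b := sx)) => n.
  by rewrite /DT /DL -sigma_sqnorm; ring.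
- apply: (bounded_seq_lin qC0 BET BEL (a := - sx^*%R) (b := sy)) => n.
  by rewrite /ET /EL -sigma_sqnorm; ring.
- apply: (bounded_seq_lin qC0 BDT BDL (a := - sx^*%R) (b := sy)) => n.
  by rewrite /DT /DL -sigma_sqnorm; ring.
(* The decrement of [DT] is q B. *)
- apply: (bounded_seq_lin qC0 BDT (bounded_seqS BDT) (a := 1) (b := -1)) => n.
  by rewrite dDT; ring.
Qed.

End Schemes.

Local Close Scope complex_scope.

(** * Return to the physical parameters *)

Theorem mainTheorem11 (R : realType)
    (c_oo eps_oo eps_s omega1 nu dt dx : R)
    (hc : 0 < c_oo) (heps_oo : 0 < eps_oo) (homega1 : 0 < omega1)
    (hdt : 0 < dt) (hdx : 0 < dx) (hnu : 0 <= nu) (heps : eps_oo <= eps_s) :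
  let lambda := c_oo * dt / dx in
  let delta := nu * dt / 2 in
  let omega := omega1 ^+ 2 * dt ^+ 2 / 2 in
  let eps := eps_s / eps_oo in
  (0 < nu -> eps_oo <= eps_s -> dt <= dx / (2 * c_oo) ->
     von_neumann_stable (step_BxByEz lambda delta omega eps) /\
     von_neumann_stable (step_BzExEy lambda delta omega eps)) /\
  (nu = 0 -> eps_oo < eps_s -> dt <= dx / (2 * c_oo) ->
     von_neumann_stable (step_BxByEz lambda delta omega eps) /\
     von_neumann_stable (step_BzExEy lambda delta omega eps)).
Proof.
move=> lambda delta omega eps.
have delta0 : 0 <= delta by rewrite divr_ge0// mulr_ge0// ltW.
have omega0 : 0 < omega by rewrite divr_gt0// mulr_gt0// exprn_gt0.
have eps1 : 1 <= eps by rewrite ler_pdivlMr// mul1r.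
have lambda0 : 0 <= lambda by rewrite divr_ge0 ?mulr_ge0 ?ltW.
(* The anharmonic case gives delta > 0 and the harmonic one eps > 1; either suffices. *)
suff main : (0 < delta) || (1 < eps) -> dt <= dx / (2 * c_oo) ->
    von_neumann_stable (step_BxByEz lambda delta omega eps) /\
    von_neumann_stable (step_BzExEy lambda delta omega eps).
  split=> [nu0 _ | _ eps_lt]; apply: main; apply/orP; [left|right].
    by rewrite divr_gt0// mulr_gt0.
  by rewrite ltr_pdivlMr// mul1r.
move=> hde; rewrite ler_pdivlMr ?mulr_gt0// => cfl.
(* The time-step condition is exactly this bound on the Courant number. *)
have lambda_le : lambda <= 1 / 2 by rewrite ler_pdivrMr//; lra.
by split=> xi; [exact: BxByEz_stable|exact: BzExEy_stable].
Qed.
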